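(* Let $P$ be a finite bounded poset with $|P|>1$, let $\mathfrak{A}(P)$ be the set of all antichains of $P$, let $\mathfrak{b}:\mathfrak{A}(P)\to\mathfrak{A}(P)$ be the blocker map, and let $\mathfrak{B}(P)=\mathfrak{b}(\mathfrak{A}(P))$ be its image. Then the restriction of $\mathfrak{b}$ to $\mathfrak{B}(P)$ is an involution, that is, for each $B\in\mathfrak{B}(P)$ one has $\mathfrak{b}(\mathfrak{b}(B))=B$.
   Context: A poset $P$ is bounded if it has a unique minimal (least) element $\hat{0}_P$ and a unique maximal (greatest) element $\hat{1}_P$. $P^{\mathrm a}$ denotes the set of atoms of $P$ (elements covering $\hat{0}_P$). For $x\in P$, $\mathfrak{I}_P(x)=\{y\in P: y\le x\}$ is the principal order ideal generated by $x$. $\mathbf{min}\,Q$ denotes the set of minimal elements of a poset $Q$. Intersecters: let $A\subseteq P$. If $A\neq\emptyset$ and $A\neq\{\hat{0}_P\}$, an element $b\in P$ is an intersecter for $A$ in $P$ if for every $a\in A-\{\hat{0}_P\}$ one has $|\mathfrak{I}_P(b)\cap\mathfrak{I}_P(a)\cap P^{\mathrm a}|\ge 1$. If $A=\{\hat{0}_P\}$, then $A$ has no intersecters in $P$. If $A=\emptyset$, then every element of $P$ is an intersecter for $A$ in $P$. The set of all intersecters for $A$ in $P$, regarded as a subposet of $P$, is denoted $\mathbf{I}(P,A)$. Blocker map: $\mathfrak{A}(P)$ includes the empty antichain, and $\mathfrak{b}(A)=\mathbf{min}\,\mathbf{I}(P,A)$ for $A\in\mathfrak{A}(P)$; in particular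 $\mathfrak{b}(\emptyset)=\{\hat{0}_P\}$ and $\mathfrak{b}(\{\hat{0}_P\})=\emptyset$. *)

(* Defs.v *)
From HB Require Import structures.
From mathcomp Require Import all_boot all_order.

Set Implicit Arguments.
Unset Strict Implicit.
Unset Printing Implicit Defensive.

Import Order.TTheory.
Local Open Scope order_scope.

Definition covers (d : Order.disp_t) (P : finPOrderType d) (x y : P) : bool :=
  (x < y) && [forall z : P, ~~ ((x < z) && (z < y))].

Definition principal_ideal (d : Order.disp_t) (P : finPOrderType d) (x : P) :
  {set P} := [set y | y <= x].

Definition is_antichain (d : Order.disp_t) (P : finPOrderType d)
  (A : {set P}) : bool :=
  [forall x in A, forall y in A, (x <= y) ==> (x == y)].

Definition antichain (d : Order.disp_t) (P : finPOrderType d) : finType :=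
  {A : {set P} | is_antichain A}.

Definition min_elements (d : Order.disp_t) (P : finPOrderType d)
  (Q : {set P}) : {set P} :=
  [set x in Q | [forall y in Q, ~~ (y < x)]].

Lemma min_elements_antichain (d : Order.disp_t) (P : finPOrderType d)
  (Q : {set P}) : is_antichain (min_elements Q).
Proof.
apply/forall_inP => x; rewrite inE => /andP[xQ _].
apply/forall_inP => y; rewrite inE => /andP[_ /forall_inP miny].
by apply/implyP => le_xy; have := miny x xQ; rewrite lt_neqAle le_xy andbT negbK.
Qed.

Definition atoms (d : Order.disp_t) (P : finTBPOrderType d) : {set P} :=
  [set x | covers \bot x].

Definition intersecter (d : Order.disp_t) (P : finTBPOrderType d)
  (A : {set P}) (b : P) : bool :=
  if A == set0 then true
  else if A == [set \bot] then false
  else [forall a in A :\ \bot,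
          (1 <= #|principal_ideal b :&: principal_ideal a :&: atoms P|)%N].

Definition intersecters (d : Order.disp_t) (P : finTBPOrderType d)
  (A : {set P}) : {set P} := [set b | intersecter A b].

Definition blocker (d : Order.disp_t) (P : finTBPOrderType d)
  (A : antichain P) : antichain P :=
  exist _ (min_elements (intersecters (val A)))
    (min_elements_antichain (intersecters (val A))).

Definition blocker_image (d : Order.disp_t) (P : finTBPOrderType d) :
  {set antichain P} := [set blocker A | A : antichain P].

(* Main.v *)
Require Import Defs.
From mathcomp Require Import all_boot all_order.

(** Say that two elements of [P] meet when some atom lies below both; this
    relation is symmetric and monotone in each argument. For an antichain [A]
    the intersecters of [A] are exactly the elements that meet every member of
    [A] ([intersecters_polar]): the two exceptional clauses of the definition
    agree with this description, because nothing meets the bottom element and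
    an antichain containing bottom is reduced to it. The set of intersecters is
    therefore the polar of [A] for a symmetric relation, and the polar map is an
    antitone Galois connection of the subsets of [P] with themselves, so that
    three polars amount to one ([polarK3]).

    Passing to minimal elements, as the blocker map does, loses nothing: by
    monotonicity, to meet all minimal elements of a set is to meet all of its
    elements ([polar_min_elements]). The intersecters of the blocker of [A] thus
    form the double polar of [A], those of its double blocker form the triple
    polar, which is the polar of [A], and taking minimal elements shows that the
    third blocker of [A] is its first one. *)

Import Order.TTheory.
Local Open Scope order_scope.

(** The size of the principal ideal is strictly increasing, so an element of [Q]
    below [x] with the smallest ideal is minimal in [Q]. *)
Lemma exists_min_element_le (d : Order.disp_t) (P : finPOrderType d)
    (Q : {set P}) (x : P) :
  x \in Q -> exists2 y, y \in min_elements Q & y <= x.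
Proof.
move=> xQ; have Qx : (x \in Q) && (x <= x) by rewrite xQ lexx.
have [y /andP[yQ le_yx] y_min] :=
  @arg_minnP _ x (fun z => (z \in Q) && (z <= x))
    (fun z => #|principal_ideal z|) Qx.
exists y => //; rewrite inE yQ; apply/forall_inP => z zQ.
apply/negP => lt_zy; have le_zx := le_trans (ltW lt_zy) le_yx.
have := y_min z; rewrite zQ le_zx leqNgt => /(_ isT)/negP; apply.
apply/proper_card/properP; split.
  by apply/subsetP => t; rewrite !inE => /le_trans->//; apply: ltW.
by exists y; rewrite !inE ?lexx// lt_geF.
Qed.

Section Polar.

Variables (d : Order.disp_t) (P : finTBPOrderType d).
Implicit Types (x y z : P) (S T : {set P}).

Definition meets x y : bool := [exists p in atoms P, (p <= x) && (p <= y)].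

Lemma meetsC x y : meets x y = meets y x.
Proof. by apply: eq_existsb => p; rewrite [(p <= x) && _]andbC. Qed.

Lemma meets_le x y z : y <= z -> meets x y -> meets x z.
Proof.
move=> le_yz /exists_inP[p p_atom /andP[le_px le_py]].
by apply/exists_inP; exists p => //; rewrite le_px (le_trans le_py le_yz).
Qed.

Lemma meets_bot x : meets x \bot = false.
Proof.
apply/exists_inP => -[p]; rewrite inE => /andP[lt0p _] /andP[_ le_p0].
by rewrite (lt_geF lt0p) in le_p0.
Qed.

Lemma meets_card x y :
  meets x y =
  (1 <= #|principal_ideal x :&: principal_ideal y :&: atoms P|)%N.
Proof.
apply/exists_inP/card_gt0P => [[p p_atom le_p]|[p]].
  by exists p; rewrite !in_setI p_atom !inE le_p.
by rewrite !in_setI => /andP[]; rewrite !inE => le_p p_atom; exists p; rewrite ?inE.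
Qed.

Definition polar S : {set P} := [set b | [forall a in S, meets b a]].

Lemma polarP S x : reflect {in S, forall a, meets x a} (x \in polar S).
Proof. by rewrite inE; apply: forall_inP. Qed.

Lemma polar_anti S T : S \subset T -> polar T \subset polar S.
Proof.
move=> /subsetP sST; apply/subsetP => x /polarP xT.
by apply/polarP => a /sST /xT.
Qed.

Lemma sub_polar2 S : S \subset polar (polar S).
Proof.
apply/subsetP => a aS; apply/polarP => b /polarP bS.
by rewrite meetsC bS.
Qed.

Lemma polarK3 S : polar (polar (polar S)) = polar S.
Proof.
by apply/eqP; rewrite eqEsubset sub_polar2 polar_anti ?sub_polar2.
Qed.

(** Every element of a finite set lies above a minimal one, and whatever meets
    the latter meets the former. *)
Lemma polar_min_elements S : polar (min_elements S) = polar S.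
Proof.
apply/eqP; rewrite eqEsubset; apply/andP; split; last first.
  by apply/polar_anti/subsetP => x; rewrite inE => /andP[].
apply/subsetP => x /polarP x_min; apply/polarP => a aS.
have [m m_min le_ma] := exists_min_element_le _ _ _ _ aS.
exact: meets_le le_ma (x_min m m_min).
Qed.

Lemma antichain_bot (A : {set P}) :
  is_antichain A -> \bot \in A -> A = [set \bot].
Proof.
move=> /forall_inP antiA A0; apply/setP => a; rewrite inE.
apply/idP/eqP => [aA|->//].
by have /forall_inP/(_ a aA) := antiA _ A0; rewrite le0x => /eqP.
Qed.

(** In the generic case the antichain avoids bottom, so removing bottom from
    the quantification changes nothing. *)
Lemma intersecters_polar (A : antichain P) :
  intersecters (val A) = polar (val A).
Proof.
apply/setP => b; rewrite !inE /intersecter.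
have [->|_] := eqVneq (val A) set0.
  by apply/esym/forall_inP => a; rewrite inE.
have [->|A_neq0] := eqVneq (val A) [set \bot].
  by apply/esym/negP => /forall_inP/(_ \bot); rewrite set11 meets_bot => /(_ isT).
have botA : \bot \notin val A.
  by apply: contra A_neq0 => /(antichain_bot _ (valP A)) ->.
apply: eq_forallb => a; rewrite in_setD1 meets_card.
by have [->|] := eqVneq a \bot; rewrite ?(negPf botA).
Qed.

Lemma intersecters_blocker (A : antichain P) :
  intersecters (val (blocker A)) = polar (polar (val A)).
Proof.
rewrite intersecters_polar -(intersecters_polar A).
exact: polar_min_elements.
Qed.

Lemma blockerK3 (A : antichain P) : blocker (blocker (blocker A)) = blocker A.
Proof.
have eqI : intersecters (val (blocker (blocker A))) = intersecters (val A).
  rewrite intersecters_blocker -intersecters_polar intersecters_blocker.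
  by rewrite polarK3 intersecters_polar.
by apply: val_inj; apply: (congr1 (@min_elements _ _) eqI).
Qed.

End Polar.

Local Close Scope order_scope.

Theorem theorem4p3 (d : Order.disp_t) (P : finTBPOrderType d)
  (P_gt1 : 1 < #|P|) (B : antichain P) (B_im : B \in blocker_image P) :
  blocker B \in blocker_image P /\ blocker (blocker B) = B.
Proof.
split; first exact: imset_f.
by have /imsetP[A _ ->] := B_im; apply: blockerK3.
Qed.
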